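(* $$F_{312}(x,y)=\frac{1-x^2+x^2y-\sqrt{1+2x^2-2x^2y+x^4-2x^4y+x^4y^2-4x}}{2x(1+xy-x)}.$$
   Context: The pattern $312$ is written without dashes, so an occurrence of $312$ in $\pi=\pi_1\cdots\pi_n\in S_n$ is a position $i$ with $\pi_{i+1}<\pi_{i+2}<\pi_i$. A permutation is $1\text{-}3\text{-}2$-avoiding if there are no positions $a<b<c$ with $\pi_a<\pi_c<\pi_b$. $f_{\tau;r}(n)$ is the number of $1\text{-}3\text{-}2$-avoiding permutations in $S_n$ containing exactly $r$ occurrences of $\tau$ (with $S_0$ consisting of the empty permutation), and $F_\tau(x,y)=\sum_{n,r\ge 0} f_{\tau;r}(n)x^ny^r$, a formal power series in $x$ with coefficients in $\mathbb Z[y]$. The square root denotes the formal power series in $x$ with constant term $1$. *)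

(* Defs.v *)
From HB Require Import structures.
From mathcomp Require Import all_boot all_order all_fingroup all_algebra.
From mathcomp Require Import boolp classical_sets.

Set Implicit Arguments.
Unset Strict Implicit.
Unset Printing Implicit Defensive.

Import GRing.Theory.

Local Open Scope ring_scope.

(* [fps R] is the ring R[[x]]; it is an integral domain when R is one, so that
   quotients of power series can be taken in the field [{fraction fps R}]. *)
Record fps (R : Type) := Fps { fps_coef :> nat -> R }.

Lemma fpsP (R : Type) (f g : fps R) : (forall n, f n = g n) <-> f = g.
Proof.
split=> [|->//]; case: f g => [f] [g] /= fg.
by congr Fps; apply/funext.
Qed.

HB.instance Definition _ (R : Type) := gen_eqMixin (fps R).
HB.instance Definition _ (R : Type) := gen_choiceMixin (fps R).

Section FpsZmodule.
Variable R : zmodType.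
Implicit Types f g h : fps R.

Definition fps_zero : fps R := Fps (fun=> 0).
Definition fps_opp f : fps R := Fps (fun n => - f n).
Definition fps_add f g : fps R := Fps (fun n => f n + g n).

Lemma fps_addA : associative fps_add.
Proof. by move=> f g h; apply/fpsP => n /=; rewrite addrA. Qed.
Lemma fps_addC : commutative fps_add.
Proof. by move=> f g; apply/fpsP => n /=; rewrite addrC. Qed.
Lemma fps_add0 : left_id fps_zero fps_add.
Proof. by move=> f; apply/fpsP => n /=; rewrite add0r. Qed.
Lemma fps_addN : left_inverse fps_zero fps_opp fps_add.
Proof. by move=> f; apply/fpsP => n /=; rewrite addNr. Qed.

HB.instance Definition _ :=
  GRing.isZmodule.Build (fps R) fps_addA fps_addC fps_add0 fps_addN.

Lemma fps_coef0 n : (0 : fps R) n = 0. Proof. by []. Qed.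
Lemma fps_coefN f n : (- f) n = - f n. Proof. by []. Qed.
Lemma fps_coefD f g n : (f + g) n = f n + g n. Proof. by []. Qed.
Lemma fps_coefB f g n : (f - g) n = f n - g n. Proof. by []. Qed.
End FpsZmodule.

Section FpsRing.
Variable R : comNzRingType.
Implicit Types f g h : fps R.

Definition fpsC (c : R) : fps R := Fps (fun n => if n == 0%N then c else 0).
Definition fpsX : fps R := Fps (fun n => (n == 1%N)%:R).
Definition fps_mul f g : fps R := Fps (fun n => \sum_(j < n.+1) f j * g (n - j)%N).

Let trunc m f : {poly R} := \poly_(i < m.+1) f i.

Let truncE m f i : (i <= m)%N -> (trunc m f)`_i = f i.
Proof. by move=> im; rewrite coef_poly ltnS im. Qed.

Let coef_mul m f g i : (i <= m)%N ->
  fps_mul f g i = (trunc m f * trunc m g)`_i.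
Proof.
move=> im; rewrite coefM; apply: eq_bigr => -[j /= ji] _.
by rewrite !truncE // ?(leq_trans (leq_subr _ _) im) // (leq_trans _ im).
Qed.

Lemma fps_mulC : commutative fps_mul.
Proof.
by move=> f g; apply/fpsP => n; rewrite !(@coef_mul n) // mulrC.
Qed.

Lemma fps_mulA : associative fps_mul.
Proof.
move=> f g h; apply/fpsP => n.
transitivity (trunc n f * (trunc n g * trunc n h))`_n.
  rewrite coefM; apply: eq_bigr => -[j /= jn] _.
  by rewrite truncE // -coef_mul // leq_subr.
rewrite mulrA coefM; apply: eq_bigr => -[j /= jn] _.
by rewrite (truncE _ (leq_subr _ _)) -coef_mul.
Qed.

Lemma fps_mul1 : left_id (fpsC 1) fps_mul.
Proof.
move=> f; apply/fpsP => n /=; rewrite big_ord_recl /= mul1r subn0.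
by rewrite big1 ?addr0 // => i _; rewrite mul0r.
Qed.

Lemma fps_mulDl : left_distributive fps_mul +%R.
Proof.
move=> f g h; apply/fpsP => n; rewrite fps_coefD /= -big_split /=.
by apply: eq_bigr => i _; rewrite mulrDl.
Qed.

Lemma fps_oner_neq0 : fpsC 1 != 0.
Proof. by apply/eqP => /fpsP/(_ 0%N)/= /eqP; rewrite oner_eq0. Qed.

HB.instance Definition _ := GRing.Zmodule_isComNzRing.Build (fps R)
  fps_mulA fps_mulC fps_mul1 fps_mulDl fps_oner_neq0.

Lemma fps_coef1 n : (1 : fps R) n = (n == 0%N)%:R.
Proof. by case: n. Qed.

Lemma fps_coefM f g n : (f * g) n = \sum_(j < n.+1) f j * g (n - j)%N.
Proof. by []. Qed.

Definition fps_unit : {pred fps R} := [pred f | `[< exists g, g * f = 1 >]].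
Definition fps_inv f : fps R := xget f [set g | g * f = 1].

Lemma fps_mulVx : {in fps_unit, left_inverse 1 fps_inv *%R}.
Proof. by move=> f /asboolP fP; exact: (xgetPex f fP). Qed.

Lemma fps_unitPl f g : g * f = 1 -> fps_unit f.
Proof. by move=> gf; apply/asboolP; exists g. Qed.

Lemma fps_invr_out : {in [predC fps_unit], fps_inv =1 id}.
Proof.
move=> f /asboolPn fP; rewrite /fps_inv xgetPN // => g /= gf.
by apply: fP; exists g.
Qed.

HB.instance Definition _ := GRing.ComNzRing_hasMulInverse.Build (fps R)
  fps_mulVx fps_unitPl fps_invr_out.
End FpsRing.

Section FpsIdomain.
Variable R : idomainType.
Implicit Types f g s : fps R.

Lemma fps_mulf_eq0 : GRing.integral_domain_axiom (fps R).
Proof.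
have lowest f : f != 0 -> exists2 m, f m != 0 & forall i, (i < m)%N -> f i = 0.
  move=> f0; have exf : exists n, f n != 0.
    apply: contrapT => nf; move/eqP: f0; apply; apply/fpsP => n.
    by apply/eqP; apply: contrapT => /negP fn; apply: nf; exists n.
  case: (ex_minnP exf) => m fm minm; exists m => // i im.
  by apply/eqP; apply: contraTT im => /minm; rewrite leqNgt.
move=> f g fg0; apply/norP => -[/lowest[m fm ltm] /lowest[k gk ltk]].
move/fpsP/(_ (m + k)%N): fg0; rewrite fps_coefM.
have mlt : (m < (m + k).+1)%N by rewrite ltnS leq_addr.
rewrite (bigD1 (Ordinal mlt)) //= addKn big1 ?addr0.
  by move/eqP; rewrite mulf_eq0 (negPf fm) (negPf gk).
move=> [j /= jlt]; rewrite -val_eqE /= => jm.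
have [jltm|] := ltnP j m; first by rewrite ltm // mul0r.
rewrite leq_eqVlt eq_sym (negPf jm) /= => mj.
by rewrite ltk ?mulr0 // ltn_subLR // ltn_add2r.
Qed.

HB.instance Definition _ :=
  GRing.ComUnitRing_isIntegral.Build (fps R) fps_mulf_eq0.

(* The value is 0 when no such series exists; it is unique, see [fps_sqrtE]. *)
Definition fps_sqrt f : fps R := xget 0 [set s | s ^+ 2 = f /\ s 0%N = 1].

Lemma fps_sqrtE f s :
  (2 : R) != 0 -> s ^+ 2 = f -> s 0%N = 1 -> fps_sqrt f = s.
Proof.
move=> two0 sf s1; apply: xget_unique; first by split.
move=> t [tf t1]; apply/eqP; rewrite -subr_eq0.
have /eqP : (t - s) * (t + s) = 0 by rewrite -subr_sqr tf sf subrr.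
rewrite mulf_eq0 => /orP[//|/eqP/fpsP/(_ 0%N)].
by rewrite fps_coefD s1 t1 => /eqP; rewrite (negPf two0).
Qed.
End FpsIdomain.

Notation "x %:F" := (@FracField.tofrac _ x) : ring_scope.

(* Positions and values are numbered from 0, which does not affect patterns. *)
Definition avoids132 n (s : 'S_n) : bool :=
  ~~ [exists a : 'I_n, exists b : 'I_n, exists c : 'I_n,
        [&& (a < b)%N, (b < c)%N, (s a < s c)%N & (s c < s b)%N]].

Definition occ312 n (s : 'S_n) : nat :=
  #|[set i : 'I_n | [exists j : 'I_n, exists k : 'I_n,
       [&& j == i.+1 :> nat, k == i.+2 :> nat,
           (s j < s k)%N & (s k < s i)%N]]]|.

Definition f312 (r n : nat) : nat :=
  #|[set s : 'S_n | avoids132 s && (occ312 s == r)]|.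

(* The sum over r is cut at r <= n, which loses nothing by [F312_coef]. *)
Definition F312 : fps {poly int} :=
  Fps (fun n => \poly_(r < n.+1) (f312 r n)%:R).

Lemma F312_coef (n r : nat) : (F312 n)`_r = (f312 r n)%:R.
Proof.
rewrite coef_poly; case: ltnP => // nr.
rewrite /f312 (_ : [set s | _] = finset.set0) ?cards0 //; apply/setP => s.
rewrite finset.in_set0 inE; apply/negbTE/negP => /andP[_ /eqP occ].
have := max_card (mem [set i : 'I_n | [exists j : 'I_n, exists k : 'I_n,
       [&& j == i.+1 :> nat, k == i.+2 :> nat,
           (s j < s k)%N & (s k < s i)%N]]]).
by rewrite card_ord -[X in (X <= _)%N]/(occ312 s) occ leqNgt nr.
Qed.

(* Main.v *)
(* Split a 132-avoiding word at its maximum n: it is u' n v with u' above v, u'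
   order-isomorphic to an arbitrary avoider u and v an arbitrary avoider. Its
   occurrences of 312 are those of u and v, plus one if v begins with an ascent.
   With H counting the avoiders that begin with an ascent and G = F + (y-1) H
   this gives F = 1 + x F G and H = x (x + H) G. Eliminating G yields
   H = x (F - 1), hence a quadratic equation for F, and the square root is
   1 - x^2 + x^2 y - 2 x (1 + x y - x) F. *)

Require Import Defs.
From mathcomp Require Import all_boot all_order all_fingroup all_algebra.
From mathcomp Require Import zify ring.
Import GRing.Theory.
Local Open Scope ring_scope.

(** * Avoidance and consecutive occurrences for words of natural numbers *)

Section Words.
Local Open Scope nat_scope.
Implicit Types (u v w : seq nat) (m n k : nat).

(** A letter [a] placed in front of the word is then the 1 of no occurrence of 132, which lets
    avoidance be defined by recursion. *)
Definition no_inversion_above a : seq nat -> bool :=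
  pairwise (fun b c => ~~ ((a < c) && (c < b))).

Fixpoint avoid132 w : bool :=
  if w is a :: t then no_inversion_above a t && avoid132 t else true.

Definition starts312 w : bool :=
  if w is [:: a, b, c & _] then (b < c) && (c < a) else false.

Fixpoint occ_word w : nat :=
  if w is a :: t then starts312 w + occ_word t else 0.

Definition starts_ascent w : bool :=
  if w is [:: a, b & _] then a < b else false.

Definition avoiders n : seq (seq nat) :=
  [seq w <- permutations (iota 0 n) | avoid132 w].

(** Inverse of the splitting at the maximum: shifting [u] by [size v] puts it just above [v], and
    the middle letter is the new maximum. *)
Definition glue u v : seq nat :=
  [seq size v + i | i <- u] ++ (size u + size v) :: v.

Lemma mem_avoiders n w :
  (w \in avoiders n) = avoid132 w && perm_eq w (iota 0 n).
Proof. by rewrite mem_filter mem_permutations. Qed.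

Lemma avoiders_uniq n : uniq (avoiders n).
Proof. exact/filter_uniq/permutations_uniq. Qed.

Lemma size_avoider n w : w \in avoiders n -> size w = n.
Proof. by rewrite mem_avoiders => /andP[_ /perm_size->]; rewrite size_iota. Qed.

Lemma avoider_lt n w : w \in avoiders n -> all (gtn n) w.
Proof.
rewrite mem_avoiders => /andP[_ /perm_mem ws].
by apply/allP => i; rewrite ws mem_iota.
Qed.

Lemma avoid132_nthP w :
  reflect (forall a b c, a < b -> b < c -> c < size w ->
             ~~ ((nth 0 w a < nth 0 w c) && (nth 0 w c < nth 0 w b)))
          (avoid132 w).
Proof.
elim: w => [|x w IHw] /=; first by constructor.
apply: (iffP andP) => [[/(pairwiseP 0) px /IHw aw] [|a] [|b] [|c] //= ab bc cw|aw].
- by apply: px => //=; rewrite inE; lia.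
- exact: aw.
split; last by apply/IHw => a b c ab bc cw; exact: (aw a.+1 b.+1 c.+1).
apply/(pairwiseP 0) => b c bw cw bc.
by have := aw 0 b.+1 c.+1; apply.
Qed.

Lemma occ_word_nth w : occ_word w =
  \sum_(i < size w) ((nth 0 w i.+1 < nth 0 w i.+2) && (nth 0 w i.+2 < nth 0 w i)).
Proof.
elim: w => [|x w IHw] /=; first by rewrite big_ord0.
rewrite big_ord_recl /= IHw; congr (_ + _).
(* A window running past the end reads the default 0 as its last letter; nothing is below 0, so it
   contributes nothing. *)
by case: w {IHw} => [|b [|c w]] //=; rewrite ltn0.
Qed.

Lemma occ_word_map m w : occ_word [seq m + i | i <- w] = occ_word w.
Proof.
elim: w => //= a w ->; congr (_ + _).
by case: w => [|b [|c w]] //=; rewrite !ltn_add2l.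
Qed.

Lemma avoid132_map m w : avoid132 [seq m + i | i <- w] = avoid132 w.
Proof.
elim: w => //= a w ->; congr (_ && _).
rewrite /no_inversion_above pairwise_map; apply: eq_pairwise => b c /=.
by rewrite !ltn_add2l.
Qed.

(** * Splitting an avoider at its maximum *)

Lemma occ_word_cons_top n v :
  all (gtn n) v -> occ_word (n :: v) = starts_ascent v + occ_word v.
Proof.
by case: v => [|a [|b v]] //= /and3P[_ -> _]; rewrite andbT.
Qed.

(** A 312 has its largest letter first, so a window with [n] in second or third place is never an
    occurrence; the window starting at [n] is one exactly when [v] begins with an ascent. *)
Lemma occ_word_cat_top n u v : all (gtn n) u -> all (gtn n) v ->
  occ_word (u ++ n :: v) = occ_word u + (starts_ascent v + occ_word v).
Proof.
move=> un vn; elim: u un => [_|a u IHu /= /andP[an un]].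
  exact: occ_word_cons_top.
rewrite IHu // addnA; congr (_ + _ + _).
case: u un {IHu} => [_|b [_|c u]] //=; last by move: an => /=; lia.
by case: v vn => //= c v /andP[cn _]; move: cn => /=; lia.
Qed.

(** If some [a] of [u] were below some [c] of [v], then [a], [n], [c] would form 132. Conversely,
    when [v] lies below [u], no 132 uses [n] or letters of both parts. Disjointness turns [c] not
    above [a] into [c] below [a]. *)
Lemma avoid132_cat_top n u v : all (gtn n) u -> all (gtn n) v ->
  (forall a c, a \in u -> c \in v -> c != a) ->
  avoid132 (u ++ n :: v) =
    [&& avoid132 u, avoid132 v & all (fun a => all (gtn a) v) u].
Proof.
move=> un vn.
elim: u un => [|a u IHu] /=.
  move=> _ _; rewrite andbT /no_inversion_above; case: avoid132; rewrite ?andbF// andbT.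
  apply/(pairwiseP 0) => b c bv cv _; apply/negP.
  by move/allP: vn => /(_ _ (mem_nth 0 cv)) /=; lia.
move=> /andP[an un] uv.
rewrite IHu //; last by move=> b c bu; apply: uv; rewrite inE bu orbT.
rewrite /no_inversion_above pairwise_cat /= allrel_consr.
have -> : all (fun b => ~~ ((a < n) && (n < b))) u.
  by apply/allP => b /(allP un) /=; lia.
have E : all (fun c => ~~ ((a < c) && (c < n))) v = all (gtn a) v.
  apply: eq_in_all => c cv /=; have := uv a c; rewrite inE eqxx /= => /(_ isT cv).
  by move/allP: vn => /(_ _ cv) /=; lia.
rewrite E; have [va|] := boolP (all (gtn a) v); last by rewrite /= !andbF.
have -> : pairwise (fun b c => ~~ ((a < c) && (c < b))) v.
  apply/(pairwiseP 0) => b c bv cv _; apply/negP.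
  by move/allP: va => /(_ _ (mem_nth 0 cv)) /=; lia.
have -> : allrel (fun b c => ~~ ((a < c) && (c < b))) u v.
  apply/allrelP => b c _ cv.
  by move/allP: va => /(_ _ cv) /=; lia.
by rewrite /= !andbT; case: pairwise; case: avoid132.
Qed.

(** As [v] lies below [u], sorting each part and concatenating gives a sorted word, hence
    [iota 0 n]; cutting it after [size v] letters identifies both parts. *)
Lemma perm_iota_cat u v n : all (fun a => all (gtn a) v) u ->
  perm_eq (v ++ u) (iota 0 n) ->
  perm_eq v (iota 0 (size v)) /\ perm_eq u (iota (size v) (size u)).
Proof.
move=> vu p.
have sz : n = size v + size u.
  by rewrite -size_cat (perm_size p) size_iota.
have : sort leq v ++ sort leq u = iota 0 (size v) ++ iota (size v) (size u).
  rewrite -[X in iota X (size u)]add0n -iotaD -sz; apply: (sorted_eq leq_trans anti_leq).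
  - rewrite sorted_pairwise ?pairwise_cat; last exact: leq_trans.
    rewrite -!sorted_pairwise ?sort_sorted; try exact: leq_trans; try exact: leq_total.
    rewrite !andbT; apply/allrelP => c a; rewrite !mem_sort => cv au.
    by move/allP: vu => /(_ _ au)/allP/(_ _ cv) /ltnW.
  - exact: iota_sorted.
  - by apply: perm_trans p; apply: perm_cat; rewrite perm_sort.
move/eqP; rewrite eqseq_cat ?size_sort ?size_iota // => /andP[/eqP <- /eqP <-].
by rewrite ![perm_eq _ (sort _ _)]perm_sym !perm_sort.
Qed.

Lemma perm_iota_top n u v :
  perm_eq (u ++ n :: v) (iota 0 n.+1) = perm_eq (v ++ u) (iota 0 n).
Proof.
by rewrite -addn1 iotaD add0n perm_catC perm_sym perm_catC /= perm_cons perm_sym.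
Qed.

Lemma perm_iota_shift m k u :
  perm_eq [seq m + i | i <- u] (iota m k) = perm_eq u (iota 0 k).
Proof.
rewrite -[X in iota X k]addn0 iotaDl; apply/idP/idP; last exact: perm_map.
by apply: perm_map_inj; exact: addnI.
Qed.

Lemma all_lt_shift m k u :
  all (gtn k) u -> all (gtn (k + m)) [seq m + i | i <- u].
Proof. by move=> uk; rewrite all_map; apply: sub_all uk => i /=; lia. Qed.

Lemma glue_avoider k m u v : u \in avoiders k -> v \in avoiders m ->
  glue u v \in avoiders (k + m).+1.
Proof.
move=> uk vm; have [su sv] := (size_avoider _ _ uk, size_avoider _ _ vm).
have [lu lv] := (avoider_lt _ _ uk, avoider_lt _ _ vm).
move: uk vm; rewrite !mem_avoiders /glue su sv => /andP[au pu] /andP[av pv].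
have vu i c : i \in [seq m + i | i <- u] -> c \in v -> c < i.
  by case/mapP => j _ -> /(allP lv) /=; lia.
rewrite perm_iota_top avoid132_cat_top.
- rewrite avoid132_map au av /=; apply/andP; split.
    by apply/allP => i iu; apply/allP => c; apply: vu.
  by rewrite addnC iotaD add0n perm_cat // perm_iota_shift.
- exact: all_lt_shift.
- by apply: sub_all lv => i /=; lia.
- by move=> i c iu cv; rewrite (ltn_eqF (vu _ _ iu cv)).
Qed.

Lemma avoider_glue n w : w \in avoiders n.+1 -> exists k u v,
  [/\ k <= n, u \in avoiders k, v \in avoiders (n - k) & w = glue u v].
Proof.
rewrite mem_avoiders => /andP[aw pw].
have : n \in w by rewrite (perm_mem pw) mem_iota /= add0n.
move/path.splitPr => wE; case: wE aw pw => u v aw.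
rewrite perm_iota_top => p.
have uvn i : i \in v ++ u -> i < n by rewrite (perm_mem p) mem_iota.
have un : all (gtn n) u by apply/allP => i iu; apply: uvn; rewrite mem_cat iu orbT.
have vn : all (gtn n) v by apply/allP => i iv; apply: uvn; rewrite mem_cat iv.
have : uniq (v ++ u) by rewrite (perm_uniq p) iota_uniq.
rewrite cat_uniq => /and3P[_ /hasPn dj _].
move: aw; rewrite avoid132_cat_top //; last first.
  by move=> a c au cv; apply: contraNneq (dj _ au) => <-.
case/and3P=> au av vu.
have [pv pu] := perm_iota_cat _ _ _ vu p.
have nE : n = size u + size v by rewrite addnC -size_cat (perm_size p) size_iota.
(* The subtraction is never truncated, since the letters of [u] fill the interval starting at
   [size v]. *)
have uE : u = [seq size v + i | i <- [seq i - size v | i <- u]].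
  rewrite -map_comp map_id_in // => i; rewrite (perm_mem pu) mem_iota /=; lia.
exists (size u), [seq i - size v | i <- u], v; split.
- by rewrite nE leq_addr.
- by rewrite mem_avoiders -(avoid132_map (size v)) -(perm_iota_shift (size v)) -uE au.
- by rewrite mem_avoiders nE addKn av.
- by rewrite /glue -uE size_map -nE.
Qed.

Lemma index_glue k m u v : u \in avoiders k -> v \in avoiders m ->
  index (k + m) (glue u v) = k.
Proof.
move=> uk vm; have [su sv] := (size_avoider _ _ uk, size_avoider _ _ vm).
rewrite /glue su sv index_cat /= eqxx addn0 size_map su ifN //.
apply/negP => /(allP (all_lt_shift m _ _ (avoider_lt _ _ uk))) /=.
by rewrite ltnn.
Qed.

(** The position of the maximum recovers [k], and for fixed [k] the glued word can be cut back into
    [u] and [v]. Hence the right side has no repetitions and comparing members suffices. *)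
Lemma avoiders_glue n : perm_eq (avoiders n.+1)
  [seq w | k <- iota 0 n.+1,
     w <- [seq glue u v | u <- avoiders k, v <- avoiders (n - k)]].
Proof.
apply: uniq_perm; first exact: avoiders_uniq.
  apply: allpairs_uniq_dep; first exact: iota_uniq.
    move=> k _; apply: allpairs_uniq; try exact: avoiders_uniq.
    move=> _ _ /allpairsP[[u v] /= [uk vk ->]] /allpairsP[[u' v'] /= [uk' vk' ->]] /=.
    rewrite /glue => /eqP.
    rewrite eqseq_cat ?size_map ?(size_avoider _ _ uk) ?(size_avoider _ _ uk') //.
    rewrite (size_avoider _ _ vk) (size_avoider _ _ vk') eqseq_cons.
    by move=> /and3P[/eqP /(inj_map (@addnI _)) -> _ /eqP ->].
  move=> p q /allpairsPdep[k [w [kn wk ->]]] /allpairsPdep[l [x [ln xl ->]]] /= wx.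
  suff kl : k = l by rewrite -wx kl.
  move: wk xl; rewrite -wx => /allpairsP[[u v] /= [uk vk ->]].
  case/allpairsP=> [[u' v'] /= [uk' vk' E]].
  rewrite -(index_glue _ _ _ _ uk vk) E -[RHS](index_glue _ _ _ _ uk' vk').
  by move: kn ln; rewrite !mem_iota => kn ln; rewrite !subnKC //; lia.
move=> w; apply/idP/allpairsPdep => [/avoider_glue[k [u [v [kn uk vk ->]]]]|].
  exists k, (glue u v); split=> //; first by rewrite mem_iota.
  by apply/allpairsP; exists (u, v).
case=> k [_ [kn /allpairsP[[u v] /= [uk vk ->]] ->]].
have -> : n = k + (n - k) by move: kn; rewrite mem_iota; lia.
exact: glue_avoider.
Qed.

(** * Permutations as words *)

Definition word n (s : 'S_n) : seq nat := [seq val (s i) | i <- enum 'I_n].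

Lemma size_word n (s : 'S_n) : size (word n s) = n.
Proof. by rewrite size_map size_enum_ord. Qed.

Lemma nth_word n (s : 'S_n) (i : 'I_n) : nth 0 (word n s) i = s i.
Proof. by rewrite (nth_map i) ?size_enum_ord // nth_ord_enum. Qed.

(** The map [word n] is injective into the rearrangements of [iota 0 n], and both sides have n!
    elements. *)
Lemma words_perm n :
  perm_eq [seq word n s | s <- enum {perm 'I_n}] (permutations (iota 0 n)).
Proof.
have wu : uniq [seq word n s | s <- enum {perm 'I_n}].
  rewrite map_inj_uniq ?enum_uniq // => s t st; apply/permP => i.
  by apply: val_inj; rewrite /= -!nth_word st.
have sub : {subset [seq word n s | s <- enum {perm 'I_n}] <= permutations (iota 0 n)}.
  move=> _ /mapP[s _ ->]; rewrite mem_permutations -val_enum_ord /word map_comp.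
  apply/perm_map/uniq_perm; rewrite ?(map_inj_uniq perm_inj) ?enum_uniq //.
  by move=> i; rewrite mem_enum -[i](permKV s) map_f // mem_enum.
have sz : size (permutations (iota 0 n)) <= size [seq word n s | s <- enum {perm 'I_n}].
  by rewrite size_permutations ?iota_uniq // size_iota size_map -cardE card_Sn.
have [_ ww] := uniq_min_size wu sub sz.
exact: uniq_perm (permutations_uniq _) ww.
Qed.

Lemma avoid132_word n (s : 'S_n) : avoid132 (word n s) = avoids132 s.
Proof.
apply/avoid132_nthP/negP => [aw /existsP[a /existsP[b /existsP[c /and4P[ab bc ac cb]]]]|aw].
  have := aw a b c ab bc; rewrite size_word => /(_ (ltn_ord c)).
  by rewrite !nth_word ac cb.
move=> a b c ab bc; rewrite size_word => cn; apply/negP => /andP[ac cb].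
have bn := ltn_trans bc cn; have an := ltn_trans ab bn.
apply: aw; apply/existsP; exists (Ordinal an).
apply/existsP; exists (Ordinal bn); apply/existsP; exists (Ordinal cn).
by rewrite /= ab bc -!nth_word /= ac.
Qed.

Lemma occ_word_word n (s : 'S_n) : occ_word (word n s) = occ312 s.
Proof.
rewrite occ_word_nth size_word /occ312 -sum1_card [RHS]big_mkcond.
apply: eq_bigr => i _; rewrite inE.
suff -> : [exists j : 'I_n, exists k : 'I_n,
    [&& j == i.+1 :> nat, k == i.+2 :> nat, s j < s k & s k < s i]] =
  ((nth 0 (word n s) i.+1 < nth 0 (word n s) i.+2) &&
     (nth 0 (word n s) i.+2 < nth 0 (word n s) i)) by case: (_ && _).
apply/existsP/idP => [[j /existsP[k /and4P[/eqP <- /eqP <-]]]|].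
  by rewrite !nth_word => -> ->.
(* If position i+2 does not exist, its default value 0 rules out the first inequality. *)
have [kn|kn] := ltnP i.+2 n; last by rewrite (@nth_default _ _ _ i.+2) ?size_word // ltn0.
move=> h; exists (Ordinal (ltnW kn)); apply/existsP; exists (Ordinal kn).
by rewrite /= !eqxx -!nth_word.
Qed.

Lemma occ_word_glue k m u v : u \in avoiders k -> v \in avoiders m ->
  occ_word (glue u v) = occ_word u + (starts_ascent v + occ_word v).
Proof.
move=> uk vm; have [su sv] := (size_avoider _ _ uk, size_avoider _ _ vm).
have [lu lv] := (avoider_lt _ _ uk, avoider_lt _ _ vm).
rewrite /glue su sv occ_word_cat_top ?occ_word_map ?all_lt_shift //.
by apply: sub_all lv => i /=; lia.
Qed.

(** For [k] = 0 the word begins with its maximum; for [k] = 1 a single letter rises to the maximum;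
    otherwise the first two letters come from [u]. *)
Lemma starts_ascent_glue k m u v : u \in avoiders k -> v \in avoiders m ->
  starts_ascent (glue u v) = starts_ascent u || (k == 1).
Proof.
move=> uk vm; have [su sv] := (size_avoider _ _ uk, size_avoider _ _ vm).
have [lu lv] := (avoider_lt _ _ uk, avoider_lt _ _ vm).
rewrite /glue -su; case: u su lu {uk} => [|a [|b u]] su lu /=.
- by case: v sv lv {vm} => //= a v sv /andP[la _]; move: la => /=; lia.
- by move: lu; rewrite -su /=; lia.
- by rewrite ltn_add2l orbF.
Qed.

End Words.

(** * Coefficients of products with x and with constants *)

Section PowerSeries.
Variable R : comNzRingType.
Implicit Types (f : fps R) (n : nat).

Lemma fps_coefXM f n : (fpsX R * f) n = if n is m.+1 then f m else 0.
Proof.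
rewrite fps_coefM big_ord_recl /= mul0r add0r; case: n => [|n].
  by rewrite big_ord0.
rewrite big_ord_recl big1 ?addr0 => [|i _]; last by rewrite /= mul0r.
by rewrite /= mul1r subn1.
Qed.

Lemma fps_coefCM (c : R) f n : (fpsC c * f) n = c * f n.
Proof.
rewrite fps_coefM big_ord_recl /= subn0 big1 ?addr0 // => i _.
by rewrite mul0r.
Qed.
End PowerSeries.

(** * Generating functions and their equations *)

Definition avoiders_fps : fps {poly int} :=
  Fps (fun n => \sum_(w <- avoiders n) 'X^(occ_word w)).

Definition ascent_avoiders_fps : fps {poly int} :=
  Fps (fun n => \sum_(w <- avoiders n) (starts_ascent w)%:R * 'X^(occ_word w)).

Section GeneratingFunctions.
Local Notation x := (fpsX {poly int}).
Local Notation y := (fpsC ('X : {poly int})).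
Local Notation F := avoiders_fps.
Local Notation H := ascent_avoiders_fps.
Local Notation G := (F + y * H - H).

Lemma sum_avoiders (V : nmodType) n (f : seq nat -> V) :
  \sum_(w <- avoiders n) f w = \sum_(s : 'S_n | avoids132 s) f (word n s).
Proof.
rewrite big_filter -(perm_big _ (words_perm n)) big_map big_enum_cond.
by apply: eq_bigl => s; rewrite avoid132_word.
Qed.

Lemma sum_avoiders_glue (V : nmodType) n (f : seq nat -> V) :
  \sum_(w <- avoiders n.+1) f w =
  \sum_(k < n.+1) \sum_(u <- avoiders k) \sum_(v <- avoiders (n - k)) f (glue u v).
Proof.
rewrite (perm_big _ (avoiders_glue n)) big_allpairs_dep.
rewrite -(big_mkord xpredT (fun k => \sum_(u <- avoiders k)
  \sum_(v <- avoiders (n - k)) f (glue u v))) /index_iota subn0.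
by apply: eq_bigr => k _; rewrite big_allpairs_dep.
Qed.

Lemma F312E : F312 = F.
Proof.
apply/fpsP => n; apply/polyP => r; rewrite F312_coef /= sum_avoiders coef_sum.
rewrite /f312 -sum1_card natr_sum big_mkcond [RHS]big_mkcond.
apply: eq_bigr => s _; rewrite inE coefXn occ_word_word eq_sym.
by case: avoids132; case: eqP.
Qed.

(* If the first letter [v_0] of [v] lies below [v_1], the maximum in front of
   [v] creates one more occurrence of 312. *)
Lemma coef_G m : G m =
  \sum_(v <- avoiders m) 'X^(starts_ascent v + occ_word v).
Proof.
rewrite fps_coefB fps_coefD fps_coefCM /= mulr_sumr -big_split -sumrB /=.
by apply: eq_bigr => v _; case: starts_ascent; rewrite ?add1n ?exprS ?add0n /=; ring.
Qed.

(** The 1 counts the empty word and the factor x the maximum; F accounts for [u], and G for [v]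
    together with the occurrence that the maximum may start. *)
Lemma avoiders_fps_eq : F = 1 + x * (F * G).
Proof.
apply/fpsP => -[|n]; rewrite fps_coefD fps_coef1 fps_coefXM.
  by rewrite /= (_ : avoiders 0 = [:: [::]]) // big_seq1 addr0.
rewrite add0r fps_coefM [LHS]/= sum_avoiders_glue; apply: eq_bigr => k _.
rewrite coef_G [F _]/= mulr_suml; apply: eq_big_seq => u uk.
rewrite mulr_sumr; apply: eq_big_seq => v vk.
by rewrite (occ_word_glue _ _ _ _ uk vk) exprD.
Qed.

Lemma avoiders1 : avoiders 1 = [:: [:: 0%N]].
Proof. by []. Qed.

(** The summand x in x + H is the one-letter [u], which has no ascent itself but gains one from the
    maximum after it. *)
Lemma ascent_avoiders_fps_eq : H = x * ((x + H) * G).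
Proof.
apply/fpsP => -[|n]; rewrite fps_coefXM.
  by rewrite /= (_ : avoiders 0 = [:: [::]]) // big_seq1 mul0r.
rewrite fps_coefM [LHS]/= sum_avoiders_glue; apply: eq_bigr => k _.
rewrite coef_G fps_coefD [x _]/= [H _]/=.
have -> : (k == 1 :> nat)%:R +
     \sum_(w <- avoiders k) (starts_ascent w)%:R * 'X^(occ_word w)
   = \sum_(w <- avoiders k) (starts_ascent w || (k == 1 :> nat))%:R *
       'X^(occ_word w) :> {poly int}.
  have [->|k1] := eqVneq (val k) 1%N.
    by rewrite avoiders1 !big_seq1 /= mul0r addr0 mul1r.
  by rewrite add0r; apply: eq_bigr => w _; rewrite orbF.
rewrite mulr_suml; apply: eq_big_seq => u uk.
rewrite mulr_sumr; apply: eq_big_seq => v vk.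
by rewrite (starts_ascent_glue _ _ _ _ uk vk) (occ_word_glue _ _ _ _ uk vk) exprD mulrA.
Qed.

Lemma ascent_avoiders_fpsE : H = x * (F - 1).
Proof.
have EF := avoiders_fps_eq; have EH := ascent_avoiders_fps_eq.
move: EF EH; move: G => g EF EH.
(* Elimination of G: H is multiplied by 1 = F - x F G, and H - x H G = x^2 G, so that H = x (x F G)
   = x (F - 1). *)
transitivity (H * (F - x * (F * g))); first by rewrite {1}EF addrK mulr1.
transitivity (F * (H - x * (H * g))); first by ring.
rewrite {1}EH; transitivity (x * (1 + x * (F * g) - 1)); first by ring.
by rewrite -EF.
Qed.

Lemma avoiders_fps_quadratic :
  x * (1 + x * y - x) * F ^+ 2 - (1 - x ^+ 2 + x ^+ 2 * y) * F + 1 = 0.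
Proof.
have := avoiders_fps_eq; rewrite ascent_avoiders_fpsE.
move: F => f Ef.
transitivity (1 + x * (f * (f + y * (x * (f - 1)) - x * (f - 1))) - f); first by ring.
by rewrite -Ef subrr.
Qed.

End GeneratingFunctions.

(** * Solving the quadratic equation *)

Theorem theorem3p4 :
  let x : fps {poly int} := fpsX {poly int} in
  let y : fps {poly int} := fpsC 'X in
  F312%:F =
    (1 - x ^+ 2 + x ^+ 2 * y
       - fps_sqrt (1 + 2 * x ^+ 2 - 2 * x ^+ 2 * y + x ^+ 4
                     - 2 * x ^+ 4 * y + x ^+ 4 * y ^+ 2 - 4 * x))%:F
    / (2 * x * (1 + x * y - x))%:F :> {fraction fps {poly int}}.
Proof.
move=> x y; rewrite F312E.
have quad : x * (1 + x * y - x) * avoiders_fps ^+ 2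
    - (1 - x ^+ 2 + x ^+ 2 * y) * avoiders_fps + 1 = 0.
  exact: avoiders_fps_quadratic.
have two_neq0 : (2 : {poly int}) != 0 by rewrite -polyC_natr polyC_eq0.
(* With A = x (1 + x y - x) and B = 1 - x^2 + x^2 y, the quadratic is A F^2 - B F + 1 = 0, and B - 2
   A F is the root to be checked. *)
rewrite (@fps_sqrtE _ _
  (1 - x ^+ 2 + x ^+ 2 * y - 2 * x * (1 + x * y - x) * avoiders_fps)) //.
- rewrite subKr [RHS]mulrC [(_ * avoiders_fps)%:F]rmorphM mulKf // tofrac_eq0.
  (* The denominator is nonzero because its coefficient of x is 2. *)
  have -> : 2 * x * (1 + x * y - x) = x * (2 + x * (2 * y - 2)) by ring.
  apply/eqP => /fpsP/(_ 1%N); rewrite fps_coefXM fps_coefD fps_coefXM addr0.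
  by rewrite -[RHS]/0 [LHS]fps_coefD !fps_coef1 => /eqP; rewrite (negPf two_neq0).
(* Completing the square: (B - 2 A F)^2 = B^2 - 4 A + 4 A (A F^2 - B F + 1), whose last term
   vanishes. *)
- transitivity ((1 - x ^+ 2 + x ^+ 2 * y) ^+ 2 - 4 * (x * (1 + x * y - x))
     + 4 * (x * (1 + x * y - x)) * (x * (1 + x * y - x) * avoiders_fps ^+ 2
         - (1 - x ^+ 2 + x ^+ 2 * y) * avoiders_fps + 1)); first by ring.
  by rewrite quad; ring.
(* The constant term is 1, which selects the right branch of the root: everything else is a multiple
   of x. *)
- rewrite [X in fps_coef X]
    (_ : _ = 1 + x * (x * y - x - 2 * (1 + x * y - x) * avoiders_fps)); last by ring.
  by rewrite fps_coefD fps_coefXM addr0.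
Qed.
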